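(* For all integers $n,l\ge 0$ and every real $x$, $$\binom{n}{l}x^l=\sum_{k=0}^{n}\binom{k}{l}B_k^n(x),$$ where $B_k^n$ denotes the Bernstein basis function.
   Context: The Bernstein basis functions are $B_k^n(x)=\binom{n}{k}x^k(1-x)^{n-k}$ for integers $0\le k\le n$ (with $0^0=1$). Binomial coefficients $\binom{k}{l}$ are $0$ when $l>k$. *)

(* Defs.v *)
From mathcomp Require Import all_boot all_order all_algebra.
From mathcomp Require Import reals.

Set Implicit Arguments.
Unset Strict Implicit.
Unset Printing Implicit Defensive.

Import GRing.Theory.
Local Open Scope ring_scope.

(* The convention 0^0 = 1 holds for [^+], so the endpoints x = 0 and x = 1 need
   no special case. The Bernstein basis is indexed by k <= n; for k > n the
   definition gives 0. *)
Definition bernstein (R : realType) (n k : nat) (x : R) : R :=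
  'C(n, k)%:R * x ^+ k * (1 - x) ^+ (n - k).

(* Main.v *)
Require Import Defs.
From mathcomp Require Import all_boot all_order all_algebra.
From mathcomp Require Import ring.
From mathcomp Require Import reals.

Import GRing.Theory.
Local Open Scope ring_scope.

(** Trinomial revision [C(n,k) C(k,l) = C(n,l) C(n-l,k-l)] pulls [C(n,l) x^l] out
    of the sum; what remains is the binomial expansion of
    [(x + (1 - x))^(n-l) = 1]. *)

(** If [n < l], both sides are 0. Otherwise only the terms with [k = i + l] survive, and trinomial
    revision applies to each of them. *)

Lemma bin_trinomial_revision (n l i : nat) : (i + l <= n)%N ->
  ('C(i + l, l) * 'C(n, i + l) = 'C(n, l) * 'C(n - l, i))%N.
Proof.
move=> le_iln.
have le_ln : (l <= n)%N by apply: leq_trans le_iln; apply: leq_addl.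
have le_inl : (i <= n - l)%N by rewrite leq_subRL // addnC.
have facts_gt0 : (0 < l`! * i`! * (n - (i + l))`!)%N by rewrite !muln_gt0 !fact_gt0.
apply/eqP; rewrite -(eqn_pmul2r facts_gt0); apply/eqP.
have := bin_fact (leq_addl i l); rewrite addnK => il_fact.
have n_fact := bin_fact le_iln.
have nl_fact := bin_fact le_ln.
have := bin_fact le_inl; rewrite -subnDA (addnC l) => nli_fact.
transitivity n`!.
  by rewrite -n_fact -il_fact; ring.
by rewrite -nl_fact -nli_fact; ring.
Qed.

Theorem theorem5 (R : realType) (n l : nat) (x : R) :
  'C(n, l)%:R * x ^+ l = \sum_(0 <= k < n.+1) 'C(k, l)%:R * bernstein n k x.
Proof.
have [lt_nl | le_ln] := ltnP n l.
  rewrite bin_small // mul0r big_nat big1 // => k /andP[_ le_kn].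
  by rewrite bin_small ?mul0r //; apply: leq_trans lt_nl.
rewrite (big_cat_nat (n := l)) //=; last exact: leqW.
rewrite big_nat big1 ?add0r => [|k /andP[_ lt_kl]]; last by rewrite bin_small ?mul0r.
(* Writing the lower bound [l] as [0 + l] lets [big_addn] shift the index to [i = k - l]. *)
rewrite -[X in \sum_(X <= _ < _) _]add0n big_addn subSn // big_mkord.
(* The summand order is that of [exprDn] applied to [(1 - x) + x]. *)
have binomial_one : \sum_(i < (n - l).+1)
    (1 - x) ^+ (n - l - i) * x ^+ i *+ 'C(n - l, i) = 1.
  by rewrite -exprDn subrK expr1n.
rewrite -[LHS]mulr1 -[X in _ * X = _]binomial_one mulr_sumr; apply: eq_bigr => i _.
have le_iln : (i + l <= n)%N by rewrite addnC -leq_subRL // -ltnS.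
rewrite /bernstein !mulrA -natrM bin_trinomial_revision // natrM.
by rewrite exprD -mulr_natl (addnC i) subnDA; ring.
Qed.
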